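(* Let $A\in\mathcal{V}$ and let $\theta$ be a congruence of $A$ with $\theta\subseteq Rad(A)$. Let $\Omega'$ be an orthogonal subset of $B(Con(A/\theta))$ which is lifted by $p_\theta$ to a subset $\Omega$ of $B(Con(A))$. Then $\Omega$ is the unique subset of $B(Con(A))$ to which $p_\theta$ lifts $\Omega'$, and $\Omega$ is orthogonal.
   Context: $\mathcal{V}$ is a congruence modular, semidegenerate variety (no nontrivial algebra has a one-element subalgebra) of finite signature, such that for every $B\in\mathcal{V}$ the set $K(B)$ of compact congruences is closed under the Freese–McKenzie commutator $[\cdot,\cdot]$. $Con(A)$ is the congruence lattice with bounds $\Delta_A,\nabla_A$; $Rad(A)$ is the intersection of all maximal congruences of $A$; $B(Con(A))$ is the Boolean algebra of complemented elements of $Con(A)$. $p_\theta:A\to A/\theta$ is the canonical surjection, and $p_\theta^{\bullet}(\alpha)=(\alpha\vee\theta)/\theta$ for $\alpha\in Con(A)$; it restricts to a Boolean morphism $B(Con(A))\to B(Con(A/\theta))$. $p_\theta$ lifts $\Omega'\subseteq Con(A/\theta)$ to $\Omega\subseteq Con(A)$ if $\Omega'=\{p_\theta^{\bullet}(\alpha):\alpha\in\Omega\}$. A subset of a Boolean algebra of congruences is orthogonal if any two distinct elements meet (equivalently, have commutator) equal to the least congruence. *)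

(* Defs.v *)
From mathcomp Require Import all_boot.
From Stdlib Require Import ClassicalEpsilon.

Set Implicit Arguments.
Unset Strict Implicit.
Unset Printing Implicit Defensive.

Record signature := Signature { sym : finType; arity : sym -> nat }.

Record algebra (S : signature) := Algebra {
  carrier :> Type;
  ops : forall f : sym S, ('I_(arity f) -> carrier) -> carrier }.
Arguments ops {S a} f _.

Inductive term (S : signature) (X : Type) : Type :=
  | Var of X
  | App (f : sym S) of ('I_(arity f) -> term S X).
Arguments Var {S X} _.
Arguments App {S X} f _.

Fixpoint eval (S : signature) (A : algebra S) (X : Type) (v : X -> A)
    (t : term S X) : A :=
  match t with
  | Var x => v x
  | App f args => ops f (fun i => eval v (args i))
  end.

Definition in_variety (S : signature) (E : term S nat -> term S nat -> Prop)
    (A : algebra S) : Prop :=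
  forall l r, E l r -> forall v : nat -> A, eval v l = eval v r.

Section Congruences.
Variables (S : signature) (A : algebra S).

Definition crel := A -> A -> Prop.

Definition csubrel (a b : crel) : Prop := forall x y, a x y -> b x y.

Definition is_cong (th : crel) : Prop :=
  (forall x, th x x) /\ (forall x y, th x y -> th y x) /\
  (forall x y z, th x y -> th y z -> th x z) /\
  (forall f (a b : 'I_(arity f) -> A),
      (forall i, th (a i) (b i)) -> th (ops f a) (ops f b)).

Definition cDelta : crel := fun x y => x = y.
Definition cNabla : crel := fun _ _ => True.

Definition cmeet (a b : crel) : crel := fun x y => a x y /\ b x y.
Definition cJoin (F : crel -> Prop) : crel :=
  fun x y => forall g, is_cong g -> (forall a, F a -> csubrel a g) -> g x y.
Definition cjoin (a b : crel) : crel :=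
  fun x y => forall g, is_cong g -> csubrel a g -> csubrel b g -> g x y.

Definition releq (a b : crel) : Prop := forall x y, a x y <-> b x y.

Definition compact_cong (a : crel) : Prop :=
  is_cong a /\
  forall F : crel -> Prop, (forall g, F g -> is_cong g) ->
    csubrel a (cJoin F) ->
    exists (n : nat) (g : 'I_n -> crel),
      (forall i, F (g i)) /\ csubrel a (cJoin (fun h => exists i, h = g i)).

Definition centralizes (a b d : crel) : Prop :=
  forall (t : term S (nat + nat)) (x y u w : nat -> A),
    (forall n, a (x n) (y n)) -> (forall n, b (u n) (w n)) ->
    let v p q := fun s : nat + nat =>
                   match s with inl n => p n | inr n => q n end in
    d (eval (v x u) t) (eval (v x w) t) -> d (eval (v y u) t) (eval (v y w) t).

(* The commutator [a, b]: the least congruence d with C(a, b; d).  In a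
   congruence modular variety this is the Freese--McKenzie commutator. *)
Definition commutator (a b : crel) : crel :=
  fun x y => forall d, is_cong d -> centralizes a b d -> d x y.

Definition boolean_cong (a : crel) : Prop :=
  is_cong a /\ exists b, is_cong b /\ releq (cmeet a b) cDelta /\
                         releq (cjoin a b) cNabla.

Definition maximal_cong (m : crel) : Prop :=
  is_cong m /\ ~ releq m cNabla /\
  forall b, is_cong b -> csubrel m b -> releq b m \/ releq b cNabla.

Definition Rad : crel := fun x y => forall m, maximal_cong m -> m x y.

Definition orthogonal (Om : crel -> Prop) : Prop :=
  forall a b, Om a -> Om b -> a <> b -> releq (cmeet a b) cDelta.

End Congruences.

Section Quotient.
Variables (S : signature) (A : algebra S) (th : crel A).

Definition quot_carrier : Type := {X : A -> Prop | exists a, X = th a}.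

Definition pcl (a : A) : quot_carrier := exist _ (th a) (ex_intro _ a erefl).

Definition rep (X : quot_carrier) : A :=
  proj1_sig (constructive_indefinite_description _ (proj2_sig X)).

Definition quot_ops (f : sym S) (X : 'I_(arity f) -> quot_carrier) : quot_carrier :=
  pcl (ops f (fun i => rep (X i))).

Definition quot_alg : algebra S := @Algebra S quot_carrier quot_ops.

(* p_theta : A -> A/theta is [pcl]; p_theta^bullet(alpha) = (alpha v theta)/theta *)
Definition pbul (a : crel A) : crel quot_alg :=
  fun X Y => exists x y, X = pcl x /\ Y = pcl y /\ cjoin a th x y.

Definition lifts (Om' : crel quot_alg -> Prop) (Om : crel A -> Prop) : Prop :=
  forall b, Om' b <-> exists a, Om a /\ b = pbul a.

End Quotient.

Definition cong_modular_variety (S : signature) (E : term S nat -> term S nat -> Prop) :=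
  forall B : algebra S, in_variety E B ->
  forall a b c : crel B, is_cong a -> is_cong b -> is_cong c -> csubrel a c ->
    releq (cjoin a (cmeet b c)) (cmeet (cjoin a b) c).

Definition semidegenerate_variety (S : signature) (E : term S nat -> term S nat -> Prop) :=
  forall B : algebra S, in_variety E B -> (exists x y : B, x <> y) ->
  ~ exists e : B, forall f (args : 'I_(arity f) -> B),
        (forall i, args i = e) -> ops f args = e.

Definition compact_commutator_closed (S : signature)
    (E : term S nat -> term S nat -> Prop) :=
  forall B : algebra S, in_variety E B ->
  forall a b : crel B, compact_cong a -> compact_cong b ->
    compact_cong (commutator a b).

(* Main.v *)
Require Import Defs.
From mathcomp Require Import all_boot.
From mathcomp Require Import boolp classical_sets.
From Stdlib Require Import Relation_Operators.

Set Implicit Arguments.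
Unset Strict Implicit.
Unset Printing Implicit Defensive.

(** Everything rests on one absorption law: if [a \/ b = Nabla] and
    [c /\ a <= b] then [c <= b].  View [c] as a subalgebra of [A * A] and let
    [Phi] be the join of the two congruences induced on it by [a] and by [b].
    The set of pairs lying in [b] is a union of [Phi]-classes: for [b]-steps by
    transitivity, for [a]-steps by the shifting lemma, a consequence of
    modularity.  As [a \/ b = Nabla], the diagonal lies in one [Phi]-class,
    which is a one-element subalgebra of the quotient by [Phi]; by
    semidegeneracy that quotient is trivial, so every pair of [c] is in [b].

    Semidegeneracy also gives, for any [e], that a congruence identifying [e]
    with all [f(e, ..., e)] is [Nabla]; the signature being finite, proper
    congruences are closed under unions of chains, hence contained in maximal
    ones, and [g \/ th = Nabla] with [th <= Rad A] forces [g = Nabla].  Both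
    claims of the theorem follow by applying absorption to complements. *)

(** * Meets and joins of congruences *)

Section CongruenceBasics.
Variables (S : signature) (A : algebra S).
Implicit Types a b c g : crel A.

Lemma releq_eq a b : releq a b -> a = b.
Proof. by move=> ab; apply/funext => x; apply/funext => y; apply/propext. Qed.

Lemma cong_join a b : is_cong (cjoin a b).
Proof.
split; first by move=> x g [? _].
split=> [x y xy g gc ag bg|].
  by case: (gc) => _ [sym _]; apply: sym; apply: xy.
split=> [x y z xy yz g gc ag bg|f u v uv g gc ag bg].
  by case: (gc) => _ [_ [tr _]]; apply: (tr _ y); [apply: xy|apply: yz].
by case: (gc) => _ [_ [_ op]]; apply: op => i; apply: uv.
Qed.

Lemma cong_meet a b : is_cong a -> is_cong b -> is_cong (cmeet a b).
Proof.
move=> [ra [sa [ta oa]]] [rb [sb [tb ob]]].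
split; first by move=> x; split.
split; first by move=> x y []; split; [apply: sa|apply: sb].
split; first by move=> x y z [axy bxy] [ayz byz]; split; [apply: ta ayz|apply: tb byz].
by move=> f u v uv; split; [apply: oa|apply: ob] => i; case: (uv i).
Qed.

Lemma cjoinl a b : csubrel a (cjoin a b).
Proof. by move=> x y axy g _ ag _; apply: ag. Qed.

Lemma cjoinr a b : csubrel b (cjoin a b).
Proof. by move=> x y bxy g _ _; apply. Qed.

Lemma cjoin_min a b g : is_cong g -> csubrel a g -> csubrel b g ->
  csubrel (cjoin a b) g.
Proof. by move=> gc ag bg x y; apply. Qed.

End CongruenceBasics.

(** * Joins of congruences as finite paths *)

Section TransitiveClosure.
Variables (S : signature) (A : algebra S) (a b : crel A).
Hypotheses (ca : is_cong a) (cb : is_cong b).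

(** Paths allow induction on steps, whereas [cjoin] can only be compared with congruences.
    Invariants such as membership of a pair in [b] are preserved by each step without defining a
    congruence. *)
Definition join_steps : crel A :=
  clos_refl_trans A (fun x y => a x y \/ b x y).

(* Operations are compatible one coordinate at a time: [hyb k] replaces the
   first [k] arguments. *)
Lemma cong_join_steps : is_cong join_steps.
Proof.
have [ra [sa [_ oa]]] := ca; have [rb [sb [_ ob]]] := cb.
split; first by move=> x; apply: rt_refl.
split.
  move=> x y; elim=> {x y} [x y [axy|bxy]|x|x y z _ yx _ zy].
  - by apply: rt_step; left; apply: sa.
  - by apply: rt_step; right; apply: sb.
  - exact: rt_refl.
  - exact: rt_trans zy yx.
split; first by move=> x y z; apply: rt_trans.
move=> f u v uv.
pose upd (h : 'I_(arity f) -> A) i x j := if j == i then x else h j.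
have step1 h i x y : join_steps x y ->
    join_steps (ops f (upd h i x)) (ops f (upd h i y)).
  elim=> {x y} [x y [axy|bxy]|x|x y z _ xy _ yz].
  - by apply: rt_step; left; apply: oa => j; rewrite /upd; case: eqP.
  - by apply: rt_step; right; apply: ob => j; rewrite /upd; case: eqP.
  - exact: rt_refl.
  - exact: rt_trans xy yz.
pose hyb k (j : 'I_(arity f)) := if j < k then v j else u j.
have hybP k : k <= arity f -> join_steps (ops f u) (ops f (hyb k)).
  elim: k => [_|k IH kf].
    have -> : hyb 0 = u by apply/funext.
    exact: rt_refl.
  apply: rt_trans (IH (ltnW kf)) _.
  have -> : hyb k = upd (hyb k) (Ordinal kf) (u (Ordinal kf)).
    apply/funext => j; rewrite /upd; case: eqP => [->|//].
    by rewrite /hyb /= ltnn.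
  have -> : hyb k.+1 = upd (hyb k) (Ordinal kf) (v (Ordinal kf)).
    apply/funext => j; rewrite /upd /hyb ltnS leq_eqVlt.
    rewrite -[_ == Ordinal kf]/(nat_of_ord j == k).
    by case: eqP => //= jk; congr v; apply: val_inj.
  exact: step1.
have := hybP _ (leqnn _); congr join_steps; congr ops.
by apply/funext => j; rewrite /hyb ltn_ord.
Qed.

End TransitiveClosure.

(** * Quotient algebras and semidegeneracy *)

Section Quotients.
Variables (S : signature) (A : algebra S) (th : crel A).
Hypothesis cth : is_cong th.

Lemma pcl_eqP (x y : A) : pcl th x = pcl th y <-> th x y.
Proof.
have [r [s [t _]]] := cth.
split=> [/(f_equal (@proj1_sig _ _)) /= ->|xy]; first exact: r.
apply: eq_exist; apply/funext => z; apply/propext.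
by split; apply: t; [apply: s|].
Qed.

Lemma pcl_rep (X : quot_carrier th) : pcl th (rep X) = X.
Proof.
have := proj2_sig (ClassicalEpsilon.constructive_indefinite_description _
  (proj2_sig X)).
by rewrite -/(rep X); case: X => X XP /= Xx; apply: eq_exist.
Qed.

Lemma eval_quot (X : Type) (v : X -> quot_alg th) (t : term S X) :
  eval v t = pcl th (eval (fun x => rep (v x)) t).
Proof.
have [_ [_ [_ op]]] := cth.
elim: t => [x|f args IH] /=; first by rewrite pcl_rep.
apply/pcl_eqP; apply: op => i; rewrite IH.
by apply/pcl_eqP; rewrite pcl_rep.
Qed.

Lemma in_variety_quot (E : term S nat -> term S nat -> Prop) :
  in_variety E A -> in_variety E (quot_alg th).
Proof.
by move=> HA l r lr v; rewrite !eval_quot (HA _ _ lr).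
Qed.

(** The class of [e] is a one-element subalgebra of the quotient, which is therefore trivial. *)
Lemma semidegenerate_collapse (E : term S nat -> term S nat -> Prop) (e : A) :
  semidegenerate_variety E -> in_variety E A ->
  (forall f, th (ops f (fun=> e)) e) -> forall x y, th x y.
Proof.
move=> Hsd HA the x y; apply: contrapT => nxy.
apply: (Hsd _ (in_variety_quot HA)).
  by exists (pcl th x), (pcl th y) => /pcl_eqP.
exists (pcl th e) => f args argsE; apply/pcl_eqP.
have [_ [_ [t op]]] := cth; apply: t (the f); apply: op => i.
by apply/pcl_eqP; rewrite pcl_rep.
Qed.

Lemma pbulP (a : crel A) (x y : A) :
  pbul (th := th) a (pcl th x) (pcl th y) <-> cjoin a th x y.
Proof.
split=> [[x' [y' [/pcl_eqP xx' [/pcl_eqP yy' xy']]]]|xy]; last by exists x, y.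
have [_ [s [t _]]] := cong_join a th.
apply: (t _ x'); first exact: cjoinr.
by apply: t xy' _; apply: s; apply: cjoinr.
Qed.

End Quotients.

(** * Congruences as subalgebras of the square, and absorption *)

Section PairAlgebra.
Variables (S : signature) (A : algebra S) (c : crel A).
Hypothesis cc : is_cong c.

Definition pair_carrier : Type := {p : A * A | c p.1 p.2}.

Lemma pair_ops_subproof f (u : 'I_(arity f) -> pair_carrier) :
  c (ops f (fun i => (sval (u i)).1)) (ops f (fun i => (sval (u i)).2)).
Proof. by have [_ [_ [_ op]]] := cc; apply: op => i; case: (u i). Qed.

Definition pair_ops f (u : 'I_(arity f) -> pair_carrier) : pair_carrier :=
  exist (fun p : A * A => c p.1 p.2)
    (ops f (fun i => (sval (u i)).1), ops f (fun i => (sval (u i)).2))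
    (pair_ops_subproof u).

Definition pair_alg : algebra S := @Algebra S pair_carrier pair_ops.

Lemma eval_pair (X : Type) (v : X -> pair_alg) (t : term S X) :
  sval (eval v t) =
  (eval (fun x => (sval (v x)).1) t, eval (fun x => (sval (v x)).2) t).
Proof.
elim: t => [x|f args IH] /=; first by case: (sval (v x)).
by congr (_, _); congr ops; apply/funext => i; rewrite IH.
Qed.

Lemma in_variety_pair (E : term S nat -> term S nat -> Prop) :
  in_variety E A -> in_variety E pair_alg.
Proof.
move=> HA l r lr v; have := eval_pair v l; have := eval_pair v r.
rewrite !(HA _ _ lr) => <-.
by case: (eval v l) => p pP; case: (eval v r) => q qP /= ?; apply: eq_exist.
Qed.

Definition pair_diag (x : A) : pair_alg :=
  exist (fun p : A * A => c p.1 p.2) (x, x) (proj1 cc x).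

Lemma pair_diag_ops f (u : 'I_(arity f) -> A) :
  pair_diag (ops f u) = ops f (fun i => pair_diag (u i)).
Proof. exact: eq_exist. Qed.

Definition pair_rel (a : crel A) : crel pair_alg :=
  fun p q => a (sval p).1 (sval q).1 /\ a (sval p).2 (sval q).2.

Lemma cong_pair_rel a : is_cong a -> is_cong (pair_rel a).
Proof.
move=> [r [s [t op]]]; split; first by split.
split; first by move=> p q []; split; apply: s.
split; first by move=> p q w [p1 p2] [q1 q2]; split; [apply: t q1|apply: t q2].
by move=> f u v uv; split; apply: op => i; case: (uv i).
Qed.

End PairAlgebra.

(** The path from [r] through [s] and [s'] to [r'] puts the pair in [((b /\ c) \/ a) /\ c]. By
    modularity this is [(b /\ c) \/ (a /\ c)], and both joinands lie below [b]. *)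
Lemma shifting (S : signature) (A : algebra S) (a b c : crel A) (s s' r r' : A) :
  is_cong a -> is_cong b -> is_cong c ->
  releq (cjoin (cmeet b c) (cmeet a c)) (cmeet (cjoin (cmeet b c) a) c) ->
  csubrel (cmeet c a) b ->
  c s s' -> c r r' -> a s r -> a s' r' -> b s s' -> b r r'.
Proof.
move=> ca cb cc modl cab css' crr' asr asr' bss'.
apply: (@cjoin_min _ _ (cmeet b c) (cmeet a c)) => //.
- by move=> x y [].
- by move=> x y [axy cxy]; apply: cab.
apply/modl; split=> //.
have [_ [sy [t _]]] := cong_join (cmeet b c) a.
apply: (t _ s); first by apply: sy; apply: cjoinr.
by apply: (t _ s'); [apply: cjoinl|apply: cjoinr].
Qed.

Lemma join_absorb (S : signature) (E : term S nat -> term S nat -> Prop)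
    (A : algebra S) (a b c : crel A) :
  cong_modular_variety E -> semidegenerate_variety E -> in_variety E A ->
  is_cong a -> is_cong b -> is_cong c ->
  releq (cjoin a b) (@cNabla S A) -> csubrel (cmeet c a) b -> csubrel c b.
Proof.
move=> Hmod Hsd HA ca cb cc ab cab x y cxy.
pose P := pair_alg cc.
pose Phi : crel P := join_steps (@pair_rel _ _ _ cc a) (@pair_rel _ _ _ cc b).
have cPhi : is_cong Phi by apply: cong_join_steps; apply: cong_pair_rel.
have [rb [sb [tb _]]] := cb.
have sat (p q : P) : Phi p q ->
    (b (sval p).1 (sval p).2 <-> b (sval q).1 (sval q).2).
  have modl := Hmod A HA (cmeet b c) a c (cong_meet cb cc) ca cc
                 (fun x y => @proj2 _ _).
  elim=> {p q} [[[p1 p2] /= pP] [[q1 q2] /= qP] [[/= h1 h2]|[/= h1 h2]]|//|p q r _ -> _ -> //].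
  - have [_ [sa _]] := ca.
    by split; apply: shifting modl cab _ _ _ _ => //; apply: sa.
  - split=> h.
      exact: tb (tb _ _ _ (sb _ _ h1) h) h2.
    exact: tb (tb _ _ _ h1 h) (sb _ _ h2).
(* Pulled back along the diagonal, [Phi] becomes a congruence of [A] above [a] and [b], hence
   total. *)
pose g : crel A := fun u v => Phi (pair_diag cc u) (pair_diag cc v).
have [rP [sP [tP oP]]] := cPhi.
have cg : is_cong g.
  split; first by move=> u; apply: rP.
  split; first by move=> u v; apply: sP.
  split; first by move=> u v w; apply: tP.
  by move=> f u v uv; rewrite /g !pair_diag_ops; apply: oP.
have gT u v : g u v.
  have : cjoin a b u v by apply/ab.
  apply: cjoin_min => // {}u {}v uv; apply: rt_step; [left|right]; by split.
have PhiT p q : Phi p q.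
  apply: (semidegenerate_collapse (E := E) (e := pair_diag cc x) cPhi Hsd).
    exact: in_variety_pair.
  by move=> f; rewrite -pair_diag_ops; apply: gT.
(* Compare [(x, y)] with the diagonal pair [(x, x)], which is in [b] by reflexivity. *)
have /sat /= [_] := PhiT (exist (fun p : A * A => c p.1 p.2) (x, y) cxy)
  (pair_diag cc x).
by apply; apply: rb.
Qed.

(** Among finitely many members of a chain one contains all the others; [X0] serves the case of an
    empty index type. The index type will be the arguments of one operation, then the symbols of the
    signature. *)
Lemma chain_finite_bound (T : Type) (I : finType) (F : set (set T)) (X0 : set T)
    (Q : I -> set T) :
  F X0 -> total_on F subset ->
  (forall i, exists2 X, F X & exists2 z, X z & Q i z) ->
  exists2 X, F X & forall i, exists2 z, X z & Q i z.
Proof.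
move=> FX0 Ftot FQ.
suff [X FX XP] : exists2 X, F X &
    forall i, i \in enum I -> exists2 z, X z & Q i z.
  by exists X => // i; apply: XP; rewrite mem_enum.
elim: (enum I) => [|i s [X FX XP]]; first by exists X0.
have [Y FY [z Yz Qz]] := FQ i.
have [XY|YX] := Ftot _ _ FX FY.
  exists Y => // j; rewrite inE => /orP[/eqP ->|/XP [w Xw Qw]]; first by exists z.
  by exists w => //; apply: XY.
exists X => // j; rewrite inE => /orP[/eqP ->|/XP //].
by exists z => //; apply: YX.
Qed.

(** * Maximal congruences and the radical *)

Section MaximalCongruences.
Local Open Scope classical_set_scope.
Variables (S : signature) (E : term S nat -> term S nat -> Prop).
Variables (A : algebra S).
Hypotheses (Hsd : semidegenerate_variety E) (HA : in_variety E A).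

Lemma sub_maximal_cong (g : crel A) : is_cong g -> ~ releq g (@cNabla S A) ->
  exists2 m, maximal_cong m & csubrel g m.
Proof.
move=> cg gT.
(* If [A] were empty, [g] would vacuously be [Nabla]. *)
have [e _] : exists e : A, True.
  apply: contrapT => nA; apply: gT => x.
  by exfalso; apply: nA; exists x.
pose rel (X : set (A * A)) : crel A := fun x y => X (x, y).
(* Properness is stated as the absence of one of finitely many fixed pairs, a form that passes to
   unions of chains. *)
pose good (X : set (A * A)) :=
  [/\ is_cong (rel X), csubrel g (rel X) &
      exists f, ~ rel X (ops f (fun=> e)) e].
pose G : set (A * A) := fun p => g p.1 p.2.
have properE (h : crel A) : is_cong h -> ~ releq h (@cNabla S A) ->
    exists f, ~ h (ops f (fun=> e)) e.
  move=> ch hT; apply: contrapT => hf; apply: hT => x y; split=> // _.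
  apply: (semidegenerate_collapse ch (e := e) Hsd HA) => f.
  by apply: contrapT => hfe; apply: hf; exists f.
have goodG : good G by split=> //; exact: (properE g).
(* [Zorn_bigcup] includes the empty chain, hence the extra disjunct. *)
pose P (X : set (A * A)) := X = set0 \/ good X.
have [F FP Ftot|M [PM Mmax]] := @Zorn_bigcup _ P.
  have [[X FX /= nX0]|F0] := pselect (exists2 X, F X & X <> set0); last first.
    left; rewrite -subset0 => z [X FX Xz]; apply: F0; exists X => // X0.
    by rewrite X0 in Xz.
  (* Dropping the empty set from the chain does not change its union. *)
  right; pose F' := [set Y | F Y /\ good Y].
  have F'X : F' X by split=> //; case: (FP _ FX).
  have F'tot : total_on F' subset by move=> ? ? [FY _] [FZ _]; apply: Ftot.
  have F'good Y : F' Y -> good Y by case.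
  have FF' z : (\bigcup_(Y in F) Y) z -> exists2 Y, F' Y & Y z.
    move=> [Y FY Yz]; exists Y => //; split=> //.
    by case: (FP _ FY) => // Y0; rewrite Y0 in Yz.
  have F'F z Y : F' Y -> Y z -> (\bigcup_(Y in F) Y) z.
    by move=> [FY _] Yz; exists Y.
  have [[rX [sX [tX oX]]] gX [f0 nf0]] := F'good _ F'X.
  split.
  - split; first by move=> x; apply: F'F F'X _; apply: rX.
    split.
      move=> x y /FF'[Y F'Y Yxy]; apply: F'F (F'Y) _.
      by have [[_ [s _]] _ _] := F'good _ F'Y; apply: s.
    split.
      move=> x y z /FF'[Y F'Y Yxy] /FF'[Z F'Z Zyz].
      have [YZ|ZY] := F'tot _ _ F'Y F'Z.
        apply: F'F (F'Z) _; have [[_ [_ [t _]]] _ _] := F'good _ F'Z.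
        by apply: t Zyz; apply: YZ.
      apply: F'F (F'Y) _; have [[_ [_ [t _]]] _ _] := F'good _ F'Y.
      by apply: t Yxy _; apply: ZY.
    move=> f u v uv.
    have [|Y F'Y Yuv] := @chain_finite_bound _ 'I_(arity f) F' X
      (fun i => [set (u i, v i)]) F'X F'tot.
      by move=> i; have /FF'[Y F'Y Yi] := uv i; exists Y => //; exists (u i, v i).
    apply: F'F (F'Y) _; have [[_ [_ [_ op]]] _ _] := F'good _ F'Y.
    by apply: op => i; have [z Yz zE] := Yuv i; rewrite zE in Yz.
  - by move=> x y gxy; apply: F'F F'X _; apply: gX.
  (* If the union contained all the pairs [(f(e, ..., e), e)], a single member of the chain would
     too. *)
  - apply: contrapT => nf.
    have [|Y F'Y Yf] := @chain_finite_bound _ (sym S) F' X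
      (fun f => [set (ops f (fun=> e), e)]) F'X F'tot.
      move=> f.
      have /FF'[Y F'Y Yf] : (\bigcup_(Y in F) Y) (ops f (fun=> e), e).
        by apply: contrapT => nfe; apply: nf; exists f.
      by exists Y => //; exists (ops f (fun=> e), e).
    have [_ _ [f nYf]] := F'good _ F'Y; apply: nYf.
    by have [z Yz zE] := Yf f; rewrite zE in Yz.
(* The empty set is not maximal, since [G] contains [(e, e)]. *)
have goodM : good M.
  case: PM => // M0; exfalso; apply: (Mmax G); last by right.
  rewrite M0; split; first by move=> z [].
  by move=> /(_ (e, e)); apply; case: cg => r _; apply: r.
have [cM gM [f nf]] := goodM.
exists (rel M) => //; split=> //; split.
  by move=> MT; apply: nf; apply/MT.
move=> b cb Mb; apply: contrapT => /not_orP[bM bT].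
apply: (Mmax (fun p => b p.1 p.2)).
  split; first by move=> [x y]; apply: Mb.
  by move=> bsM; apply: bM => x y; split=> [bxy|/Mb //]; apply: (bsM (x, y)).
right; split=> //; first by move=> x y /gM /Mb.
exact: properE.
Qed.

(** A maximal congruence above a proper [g] would also contain [th], hence their join [Nabla]. *)
Lemma join_Rad_total (g th : crel A) : is_cong g -> csubrel th (@Rad S A) ->
  releq (cjoin g th) (@cNabla S A) -> releq g (@cNabla S A).
Proof.
move=> cg thR gth; apply: contrapT => gT.
have [m mm gm] := sub_maximal_cong cg gT; have [cm [mT _]] := mm.
apply: mT => x y; split=> // _.
have : cjoin g th x y by apply/gth.
by apply: cjoin_min => // {}x {}y /thR; apply.
Qed.

End MaximalCongruences.

(** * Boolean congruences modulo a congruence below the radical *)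

Section Lifting.
Variables (S : signature) (E : term S nat -> term S nat -> Prop).
Hypotheses (Hmod : cong_modular_variety E) (Hsd : semidegenerate_variety E).
Variables (A : algebra S) (th : crel A).
Hypotheses (HA : in_variety E A) (cth : is_cong th).
Hypothesis thRad : csubrel th (@Rad S A).

(** Let [a'] be a complement of [a]. Then [a' \/ b \/ th] contains [a' \/ a = Nabla], so
    [a' \/ b = Nabla] because [th] is below the radical. As [a /\ a'] is trivial, absorption gives
    [a <= b]. *)
Lemma boolean_sub_mod_Rad (a b : crel A) : boolean_cong a -> is_cong b ->
  csubrel a (cjoin b th) -> csubrel a b.
Proof.
move=> [ca [a' [ca' [aa'0 aa'1]]]] cb ab.
apply: (@join_absorb _ E _ a' b a) => //; last first.
  by move=> x y /aa'0 <-; case: cb.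
apply: (join_Rad_total Hsd HA (cong_join _ _) thRad) => x y; split=> // _.
have : cjoin a a' x y by apply/aa'1.
have cj := cong_join (cjoin a' b) th.
apply: cjoin_min => // {}x {}y; last by move=> /(@cjoinl _ _ a' b); apply: cjoinl.
move=> /ab; apply: cjoin_min => //; last exact: cjoinr.
by move=> u v /(@cjoinr _ _ a' b); apply: cjoinl.
Qed.

Lemma pbul_inj_boolean (a b : crel A) : boolean_cong a -> boolean_cong b ->
  pbul (th := th) a = pbul b -> a = b.
Proof.
have sub (a1 b1 : crel A) : boolean_cong a1 -> boolean_cong b1 ->
    pbul (th := th) a1 = pbul b1 -> csubrel a1 b1.
  move=> Ba [cb _] pab; apply: boolean_sub_mod_Rad => // u v uv.
  by apply/(pbulP cth); rewrite -pab; apply/(pbulP cth); apply: cjoinl.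
by move=> Ba Bb pab; apply: releq_eq => x y; split; apply: sub.
Qed.

(** Let [b'] be a complement of [b]. Absorption applied to [b \/ th] and [b' \/ th] gives
    [a <= b' \/ th]; the radical removes [th], so [a /\ b <= b' /\ b], which is trivial. *)
Lemma boolean_meet_mod_Rad (a b : crel A) : boolean_cong a -> boolean_cong b ->
  csubrel (cmeet (cjoin a th) (cjoin b th)) th -> releq (cmeet a b) (@cDelta S A).
Proof.
move=> Ba [cb [b' [cb' [bb'0 bb'1]]]] abth.
have ca : is_cong a by case: Ba.
have ab' : csubrel a b'.
  apply: boolean_sub_mod_Rad => //.
  apply: (@join_absorb _ E _ (cjoin b th) (cjoin b' th) a) => //; try exact: cong_join.
    move=> x y; split=> // _; have : cjoin b b' x y by apply/bb'1.
    apply: cjoin_min => [|u v uv|u v uv]; first exact: cong_join.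
      by do 2 apply: cjoinl.
    by apply: cjoinr; apply: cjoinl.
  move=> x y [axy bxy]; apply: cjoinr; apply: abth; split=> //.
  exact: cjoinl.
move=> x y; split=> [[axy bxy]|->]; last by split; [case: ca|case: cb].
by apply/bb'0; split=> //; apply: ab'.
Qed.

End Lifting.

Theorem theorem7p3 (S : signature) (E : term S nat -> term S nat -> Prop)
  (Hmod : cong_modular_variety E)
  (Hsd : semidegenerate_variety E)
  (Hcomp : compact_commutator_closed E)
  (A : algebra S) (HA : in_variety E A)
  (th : crel A) (Hth : is_cong th) (HthRad : csubrel th (@Rad S A))
  (Om' : crel (quot_alg th) -> Prop)
  (HOm'B : forall b, Om' b -> boolean_cong b)
  (HOm'orth : orthogonal Om')
  (Om : crel A -> Prop)
  (HOmB : forall a, Om a -> boolean_cong a)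
  (Hlift : lifts Om' Om) :
  (forall Om2 : crel A -> Prop, (forall a, Om2 a -> boolean_cong a) ->
     lifts Om' Om2 -> forall a, Om2 a <-> Om a)
  /\ orthogonal Om.
Proof.
have inj := pbul_inj_boolean Hmod Hsd HA Hth HthRad.
split=> [Om2 HOm2B Hlift2 a|a b Oa Ob nab].
  (* An element of one lift has the same image as some element of the other, and injectivity on
     Boolean congruences identifies the two. *)
  have sub (O1 O2 : crel A -> Prop) : (forall a, O1 a -> boolean_cong a) ->
      (forall a, O2 a -> boolean_cong a) -> lifts Om' O1 -> lifts Om' O2 ->
      O1 a -> O2 a.
    move=> B1 B2 L1 L2 O1a.
    have /L2[b [O2b eab]] : Om' (pbul a) by apply/L1; exists a.
    by rewrite (inj _ _ (B1 _ O1a) (B2 _ O2b) eab).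
  by split; apply: sub.
apply: (boolean_meet_mod_Rad Hmod Hsd HA HthRad) => //; try exact: HOmB.
have O'a : Om' (pbul a) by apply/Hlift; exists a.
have O'b : Om' (pbul b) by apply/Hlift; exists b.
(* Orthogonality of [Om'] speaks of distinct elements only, so injectivity is needed here as
   well. *)
have npab : pbul (th := th) a <> pbul b.
  by move=> pab; apply: nab; apply: inj => //; apply: HOmB.
move=> x y [axy bxy]; apply/(pcl_eqP Hth).
by apply/(HOm'orth _ _ O'a O'b npab); split; apply/(pbulP Hth).
Qed.
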